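(* Let $R$ be a field and let $(\Gamma,E,F)$ be a Euclidean network over $R$, with internal product $\langle\cdot,\cdot\rangle$ on $\bigoplus_{\gamma\in A}F(s(\gamma))$, where $\Gamma=(A,V,s,t)$ is a finite directed graph, $E\subseteq V$, and $F$ is an $R$-representation of $\Gamma$ such that $F(v)$ is a finite-dimensional vector space for every $v\in V$. Then for each $\varphi\in\bigoplus_{v\in E}F(v)$ satisfying $\varepsilon(\varphi)=0$ there is a unique $1$-chain $f=\{f_\gamma\}_{\gamma\in A}\in\bigoplus_{\gamma\in A}F(s(\gamma))$ such that $df=\varphi$ and $\langle f,-\rangle|_{\Phi(\Gamma;F)}=0$ (i.e. $\langle f,g\rangle=0$ for all $g\in\Phi(\Gamma;F)$).
   Context: A (directed) graph $\Gamma=(A,V,s,t)$ consists of a set $A$ of arrows, a set $V$ of vertices and two functions $s,t:A\to V$ (source and target); it is finite if $A$ and $V$ are finite. An $R$-representation $F$ of $\Gamma$ is a family of $R$-modules $\{F(v)\}_{v\in V}$ together with $R$-homomorphisms $F(\alpha):F(s(\alpha))\to F(t(\alpha))$ for $\alpha\in A$. A network $(\Gamma,E,F)$ consists of a graph $\Gamma$, an arbitrary subset $E\subseteq V$ and an $R$-representation $F$ of $\Gamma$. Elements of $\bigoplus_{\gamma\in A}F(s(\gamma))$ are called $1$-chains. The map $d:\bigoplus_{\gamma\in A}F(s(\gamma))\to\bigoplus_{v\in V}F(v)$ is $$d(f)_v=\sum_{t(\gamma)=v}F(\gamma)(f_\gamma)-\sum_{s(\gamma)=v}f_\gamma,$$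 and $\Phi(\Gamma;F)=\ker d$ is the module of flows on $\Gamma$ with coefficients in $F$. $W\Gamma$ is the category of paths in $\Gamma$ (the free category on $\Gamma$), $\widetilde F:W\Gamma\to\mathrm{Mod}_R$ the unique functor extending $F$, and $\varepsilon:\bigoplus_{v\in V}F(v)\to\operatorname{colim}^{W\Gamma}\widetilde F$ the canonical homomorphism. $\bigoplus_{v\in E}F(v)$ is regarded as a subspace of $\bigoplus_{v\in V}F(v)$. For a field $R$, an internal product on an $R$-vector space $T$ is a bilinear map $\langle\cdot,\cdot\rangle:T\times T\to R$ with $\langle a,b\rangle=\langle b,a\rangle$ for all $a,b\in T$. A network together with an internal product on $\bigoplus_{\gamma\in A}F(s(\gamma))$ is Euclidean if $\langle f,f\rangle=0$ implies $f=0$. *)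

(* Defs.v *)
From HB Require Import structures.
From mathcomp Require Import all_boot all_order all_algebra.

Set Implicit Arguments.
Unset Strict Implicit.
Unset Printing Implicit Defensive.

Import GRing.Theory.
Local Open Scope ring_scope.

(* Over a finite index type, the direct sum is the module of all dependent
   families; the library only has the non-dependent instance {ffun I -> M}. *)
Definition dsum (R : nzRingType) (I : finType) (M : I -> lmodType R) : Type :=
  {dffun forall i, M i}.

Section DirectSum.
Variables (R : nzRingType) (I : finType) (M : I -> lmodType R).

Definition dsum_mk (f : forall i, M i) : dsum M := @finfun I M f.

Lemma dsum_mkE f i : dsum_mk f i = f i.
Proof. exact: ffunE. Qed.

Lemma dsumP (x y : dsum M) : (forall i, x i = y i) <-> x = y.
Proof. exact: ffunP. Qed.

HB.instance Definition _ := Choice.copy (dsum M) {dffun forall i, M i}.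

Definition dsum_zero : dsum M := dsum_mk (fun=> 0).
Definition dsum_opp (x : dsum M) : dsum M := dsum_mk (fun i => - x i).
Definition dsum_add (x y : dsum M) : dsum M := dsum_mk (fun i => x i + y i).
Definition dsum_scale (a : R) (x : dsum M) : dsum M :=
  dsum_mk (fun i => a *: x i).

Fact dsum_addA : associative dsum_add.
Proof. by move=> x y z; apply/dsumP => i; rewrite !dsum_mkE addrA. Qed.
Fact dsum_addC : commutative dsum_add.
Proof. by move=> x y; apply/dsumP => i; rewrite !dsum_mkE addrC. Qed.
Fact dsum_add0 : left_id dsum_zero dsum_add.
Proof. by move=> x; apply/dsumP => i; rewrite !dsum_mkE add0r. Qed.
Fact dsum_addN : left_inverse dsum_zero dsum_opp dsum_add.
Proof. by move=> x; apply/dsumP => i; rewrite !dsum_mkE addNr. Qed.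

HB.instance Definition _ := GRing.isZmodule.Build (dsum M)
  dsum_addA dsum_addC dsum_add0 dsum_addN.

Fact dsum_scaleA a b x : dsum_scale a (dsum_scale b x) = dsum_scale (a * b) x.
Proof. by apply/dsumP => i; rewrite !dsum_mkE scalerA. Qed.
Fact dsum_scale1 : left_id 1 dsum_scale.
Proof. by move=> x; apply/dsumP => i; rewrite !dsum_mkE scale1r. Qed.
Fact dsum_scaleDr : right_distributive dsum_scale +%R.
Proof. by move=> a x y; apply/dsumP => i; rewrite !dsum_mkE scalerDr. Qed.
Fact dsum_scaleDl x : {morph dsum_scale^~ x : a b / a + b}.
Proof. by move=> a b; apply/dsumP => i; rewrite !dsum_mkE scalerDl. Qed.

HB.instance Definition _ := GRing.Zmodule_isLmodule.Build R (dsum M)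
  dsum_scaleA dsum_scale1 dsum_scaleDr dsum_scaleDl.

End DirectSum.

Record finGraph := FinGraph {
  arrow : finType;
  vertex : finType;
  src : arrow -> vertex;
  tgt : arrow -> vertex }.

Record representation (R : nzRingType) (G : finGraph) := Representation {
  rep_obj :> vertex G -> lmodType R;
  rep_map : forall a : arrow G, {linear rep_obj (src a) -> rep_obj (tgt a)} }.

Definition finite_dimensional (R : nzRingType) (M : lmodType R) : Prop :=
  exists n, inhabited (Vector.axiom n M).

Record category := Category {
  ob :> Type;
  mor : ob -> ob -> Type;
  mor_id : forall x, mor x x;
  mor_comp : forall x y z, mor x y -> mor y z -> mor x z;
  mor_comp_idl : forall x y (p : mor x y), mor_comp (mor_id x) p = p;
  mor_comp_idr : forall x y (p : mor x y), mor_comp p (mor_id y) = p;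
  mor_compA : forall w x y z (p : mor w x) (q : mor x y) (r : mor y z),
    mor_comp p (mor_comp q r) = mor_comp (mor_comp p q) r }.

Record modFunctor (R : nzRingType) (C : category) := ModFunctor {
  fobj :> C -> lmodType R;
  fmap : forall x y : C, mor x y -> {linear fobj x -> fobj y};
  fmap_id : forall x, fmap (mor_id x) =1 id;
  fmap_comp : forall x y z (p : mor x y) (q : mor y z),
    fmap (mor_comp p q) =1 fmap q \o fmap p }.

Record cocone (R : nzRingType) (C : category) (D : modFunctor R C)
    (L : lmodType R) := Cocone {
  leg :> forall x : C, {linear D x -> L};
  leg_natural : forall (x y : C) (p : mor x y), leg y \o fmap D p =1 leg x }.

(* The universal property; all of Mod_R, not only finite-dimensional modules,
   is tested against. *)
Definition is_colimit (R : nzRingType) (C : category) (D : modFunctor R C)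
    (L : lmodType R) (c : cocone D L) : Prop :=
  forall (L' : lmodType R) (c' : cocone D L'),
    exists u : {linear L -> L'},
      (forall x, u \o c x =1 c' x) /\
      (forall u' : {linear L -> L'}, (forall x, u' \o c x =1 c' x) -> u' =1 u).

Section PathCategory.
Variable G : finGraph.

Inductive gpath (x : vertex G) : vertex G -> Type :=
  | gpath_nil : gpath x x
  | gpath_rcons (a : arrow G) of gpath x (src a) : gpath x (tgt a).

Fixpoint gpath_cat x y z (p : gpath x y) (q : gpath y z) : gpath x z :=
  match q in gpath _ z return gpath x z with
  | gpath_nil => p
  | gpath_rcons a q => gpath_rcons (gpath_cat p q)
  end.

Fact gpath_cat_nill x y (p : gpath x y) : gpath_cat (gpath_nil x) p = p.
Proof. by elim: p => //= a p ->. Qed.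
Fact gpath_cat_nilr x y (p : gpath x y) : gpath_cat p (gpath_nil y) = p.
Proof. by []. Qed.
Fact gpath_catA w x y z (p : gpath w x) (q : gpath x y) (r : gpath y z) :
  gpath_cat p (gpath_cat q r) = gpath_cat (gpath_cat p q) r.
Proof. by elim: r => //= a r ->. Qed.

Definition path_category : category :=
  Category gpath_cat_nill gpath_cat_nilr gpath_catA.

Variables (R : nzRingType) (F : representation R G).

Fixpoint rep_path x y (p : gpath x y) : {linear F x -> F y} :=
  match p in gpath _ y return {linear F x -> F y} with
  | gpath_nil => idfun
  | gpath_rcons a p => rep_map F a \o rep_path p
  end.

Fact rep_path_nil x : rep_path (gpath_nil x) =1 id.
Proof. by []. Qed.
Fact rep_path_cat x y z (p : gpath x y) (q : gpath y z) :
  rep_path (gpath_cat p q) =1 rep_path q \o rep_path p.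
Proof. by move=> m; elim: q => //= a q ->. Qed.

Definition rep_functor : modFunctor R path_category :=
  @ModFunctor R path_category F rep_path rep_path_nil rep_path_cat.

End PathCategory.

Section Flows.
Variables (R : nzRingType) (G : finGraph) (F : representation R G).

Definition chain1 := dsum (fun a : arrow G => F (src a)).
Definition chain0 := dsum F.

(* x : F w transported to F v along w = v (and 0 if w <> v); in [boundary] it
   is only used for w = v, the equation coming from the range of the sum. *)
Definition rep_cast (w : vertex G) (x : F w) (v : vertex G) : F v :=
  untag (0 : F v) id (Tagged (fun u => F u : Type) x).

Lemma rep_cast_id v (x : F v) : rep_cast x v = x.
Proof.
exact: (@untagE _ _ _ (0 : F v) v id (Tagged (fun u => F u : Type) x) erefl).
Qed.

Definition boundary (f : chain1) : chain0 := dsum_mk (fun v =>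
  \sum_(a | tgt a == v) rep_cast (rep_map F a (f a)) v -
  \sum_(a | src a == v) rep_cast (f a) v).

Definition is_flow (g : chain1) : Prop := boundary g = 0.

Definition supported_on (E : {set vertex G}) (phi : chain0) : Prop :=
  forall v, v \notin E -> phi v = 0.

Definition colim_eps (L : lmodType R) (c : cocone (rep_functor F) L)
    (phi : chain0) : L :=
  \sum_(v : vertex G) c v (phi v).

End Flows.

Section InternalProduct.
Variables (R : fieldType) (T : lmodType R).

Record internal_product := InternalProduct {
  ip_form :> {biscalar T};
  ip_sym : forall a b, ip_form a b = ip_form b a }.

Definition euclidean (ip : internal_product) : Prop :=
  forall f, ip f f = 0 -> f = 0.

End InternalProduct.

(* Main.v *)
(** A linear map vanishing on the image of [d] is a cocone on the path category,
    hence factors through [colim F~]; applied to a linear map whose kernel is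
    exactly [im d], this shows that [eps phi = 0] forces [phi] to be a boundary
    [d f0]. As the form is anisotropic, it restricts to a nondegenerate form on
    the finite-dimensional [ker d], so [f0] can be corrected by its orthogonal
    projection onto the flows; two solutions differ by a self-orthogonal flow. *)
From HB Require Import structures.
Require Import Defs.
From mathcomp Require Import all_boot all_order all_algebra.
Import GRing.Theory.
Local Open Scope ring_scope.

Section LinearMaps.
Variable R : fieldType.

(** Phrased as an equality of module structures so that case analysis on it turns [T] into a
    [vectType] everywhere in a goal, giving access to subspaces and dimensions. *)
Lemma finite_dimensional_vectType (T : lmodType R) :
  finite_dimensional T -> exists V : vectType R, V = T :> lmodType R.
Proof.
move=> [n [Tn]].
exists (HB.pack_for (vectType R) T (Lmodule_hasFinDim.Build R T Tn)).
by case: T Tn.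
Qed.

(** The fixed points of a projection onto the image of [f] are exactly that image, so the
    complementary projection serves as [u], without forming a quotient. *)
Lemma linear_cokernel (T U : lmodType R) (f : {linear T -> U}) :
    finite_dimensional T -> finite_dimensional U ->
  exists u : {linear U -> U}, forall y, u y = 0 <-> exists x, f x = y.
Proof.
move=> /finite_dimensional_vectType[T' eqT].
move=> /finite_dimensional_vectType[U' eqU].
case: T / eqT f => f; case: U / eqU f => f; pose V := limg (linfun f).
exists (\1 - projv V : 'End(U'))%VF => y; rewrite /= add_lfunE opp_lfunE id_lfunE.
split=> [|[x <-]].
  move/eqP; rewrite subr_eq0 => /eqP y_proj.
  have /memv_imgP[x _ ->] : y \in V by rewrite y_proj memv_proj.
  by exists x; rewrite lfunE.
by rewrite projv_id ?subrr // -[f x](lfunE f) memv_img ?memvf.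
Qed.

(* The Gram matrix of an anisotropic form on the kernel is injective, hence
   surjective, so orthogonal projection onto the kernel exists. *)
Lemma anisotropic_orthogonal_proj (T U : lmodType R) (b : {biscalar T})
    (f : {linear T -> U}) :
    finite_dimensional T -> finite_dimensional U ->
    (forall x, b x x = 0 -> x = 0) ->
  forall x, exists2 y, f y = 0 & forall z, f z = 0 -> b (x - y) z = 0.
Proof.
move=> /finite_dimensional_vectType[T' eqT].
move=> /finite_dimensional_vectType[U' eqU].
case: T / eqT b f => b f; case: U / eqU f => f b_aniso x.
pose K := lker (linfun f).
have inK z : f z = 0 <-> z \in K.
  by rewrite memv_ker lfunE; split=> [->|/eqP].
pose e := vbasis K.
pose gram (z : T') : 'rV[R]_(\dim K) := \row_i b z e`_i.
have gram_lin : linear gram.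
  by move=> a z z'; apply/rowP => i; rewrite !mxE linearPl.
pose gramL := GRing.isLinear.Build R T' 'rV[R]_(\dim K) *:%R gram gram_lin.
pose gram' : {linear T' -> 'rV[R]_(\dim K)} := HB.pack gram gramL.
have gram0 z w : gram z = 0 -> w \in K -> b z w = 0.
  move=> /rowP z0 /coord_vbasis ->; rewrite linear_sumr big1 // => i _.
  by have := z0 i; rewrite !mxE linearZr_LR /= => ->; rewrite mulr0.
have gram_full : (linfun gram' @: K)%VS = fullv.
  apply/eqP; rewrite eqEdim subvf limg_dim_eq ?dimvf ?dim_matrix ?[leqLHS]mul1n //=.
  apply/eqP; rewrite -subv0; apply/subvP => z.
  rewrite memv_cap (memv_ker (linfun gram')) (lfunE gram') memv0 => /andP[Kz /eqP z0].
  by apply/eqP/b_aniso/gram0.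
(* The projection of [x] is the [y] in [K] having the same products as [x] with the basis of [K]. *)
have /memv_imgP[y Ky] : gram x \in (linfun gram' @: K)%VS.
  by rewrite gram_full memvf.
rewrite (lfunE gram') /= => xy; exists y => [|z /inK]; first exact/inK.
apply: gram0; apply/rowP => i; rewrite !mxE linearBl /=.
by move/rowP/(_ i): xy; rewrite !mxE => ->; rewrite subrr.
Qed.

End LinearMaps.

Lemma dsum_finite_dimensional (R : nzRingType) (I : finType)
    (M : I -> lmodType R) :
  (forall i, finite_dimensional (M i)) -> finite_dimensional (dsum M).
Proof.
move=> finM.
have /fin_all_exists[n Mn] i : exists n, inhabited (Vector.axiom n (M i)).
  by have [n ?] := finM i; exists n.
(* Coordinate isomorphisms merely exist for each [i]; finiteness of [I] allows choosing them all at
   once without an axiom. *)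
have /fin_all_exists[h Mh] i : exists h : (M i -> 'rV[R]_(n i)) *
    ('rV[R]_(n i) -> M i), [/\ linear h.1, cancel h.1 h.2 & cancel h.2 h.1].
  by have [[h h_lin [h' hK h'K]]] := Mn i; exists (h, h').
(* The coordinates of all summands are concatenated, indexed by pairs of a summand and a position in
   it. *)
pose J : finType := {i : I & 'I_(n i)}.
pose to (x : dsum M) : 'rV[R]_#|J| :=
  \row_k (h (tag (enum_val k))).1 (x _) 0 (tagged (enum_val k)).
pose of_ (y : 'rV[R]_#|J|) : dsum M :=
  dsum_mk (M := M)
    (fun i => (h i).2 (\row_j y 0 (enum_rank (Tagged (fun i => 'I_(n i)) j)))).
exists #|J|; constructor; exists to.
  move=> a x y; apply/rowP => k; rewrite !mxE.
  case: (Mh (tag (enum_val k))) => h_lin _ _.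
  by rewrite !dsum_mkE h_lin !mxE.
exists of_ => [x|y].
  apply/dsumP => i; rewrite dsum_mkE; have [_ hK _] := Mh i.
  rewrite -[RHS]hK; congr (h i).2; apply/rowP => j.
  by rewrite !mxE enum_rankK.
apply/rowP => k; rewrite mxE dsum_mkE.
case: (Mh (tag (enum_val k))) => _ _ ->.
by rewrite mxE taggedK enum_valK.
Qed.

Section Boundary.
Variables (R : nzRingType) (G : finGraph) (F : representation R G).

Lemma rep_cast_neq (w v : vertex G) (x : F w) : w != v -> rep_cast x v = 0.
Proof. by move=> neq; rewrite /rep_cast untag_dflt. Qed.

Lemma rep_cast_linear (w v : vertex G) :
  linear (fun x : F w => rep_cast x v).
Proof.
move=> a x y; have [<-|neq] := eqVneq w v; first by rewrite !rep_cast_id.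
by rewrite !rep_cast_neq // scaler0 addr0.
Qed.

Lemma rep_cast0 (w v : vertex G) : rep_cast (0 : F w) v = 0.
Proof.
by have [<-|/rep_cast_neq->] := eqVneq w v; first exact: rep_cast_id.
Qed.

Lemma boundary_linear : linear (@boundary R G F).
Proof.
move=> k f g; apply/dsumP => v; rewrite !dsum_mkE scalerBr !scaler_sumr.
rewrite addrACA -opprD -!big_split.
congr (_ - _); apply: eq_bigr => a _; rewrite dsum_mkE.
  by rewrite !dsum_mkE linearP rep_cast_linear.
by rewrite !dsum_mkE rep_cast_linear.
Qed.

HB.instance Definition _ :=
  GRing.isLinear.Build R (chain1 F) (chain0 F) *:%R _ boundary_linear.

Definition chain0_single (w : vertex G) (x : F w) : chain0 F :=
  dsum_mk (M := F) (rep_cast x).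

Lemma chain0_single_linear w : linear (chain0_single w).
Proof. by move=> a x y; apply/dsumP => v; rewrite !dsum_mkE rep_cast_linear. Qed.

HB.instance Definition _ w :=
  GRing.isLinear.Build R (F w) (chain0 F) *:%R _ (chain0_single_linear w).

Lemma chain0_sum_single (phi : chain0 F) :
  phi = \sum_v chain0_single _ (phi v).
Proof.
have evD v : {morph (fun x : chain0 F => x v) : x y / x + y}.
  by move=> x y; rewrite dsum_mkE.
have ev0 v : (0 : chain0 F) v = 0 by rewrite dsum_mkE.
apply/dsumP => v; rewrite (big_morph _ (evD v) (ev0 v)).
rewrite (bigD1 v) //= dsum_mkE rep_cast_id big1 ?addr0 // => w neq.
by rewrite dsum_mkE rep_cast_neq.
Qed.

(** The chain concentrated on [a] works. Its two terms are computed separately, so loops need no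
    special treatment. *)
Lemma boundary_single (a : arrow G) (x : F (src a)) :
  exists f : chain1 F,
    boundary f = chain0_single _ (rep_map F a x) - chain0_single _ x.
Proof.
pose M b : lmodType R := F (src b).
pose f : chain1 F :=
  dsum_mk (M := M) (fun b => untag (0 : M b) id (Tagged (fun b => M b : Type) x)).
have fa : f a = x.
  rewrite dsum_mkE.
  exact: (@untagE _ _ _ (0 : M a) a id (Tagged (fun b => M b : Type) x) erefl).
have fb b : b != a -> f b = 0.
  by move=> ba; rewrite dsum_mkE untag_dflt //= eq_sym.
exists f; apply/dsumP => v; rewrite !dsum_mkE; congr (_ - _).
  (* When [v] is not the target of [a], the sum omits the term and [rep_cast] is 0 as well. *)
  rewrite big_mkcond (bigD1 a) //= fa big1 ?addr0 => [|b /fb ->].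
    by case: ifPn => // /rep_cast_neq ->.
  by rewrite linear0 rep_cast0 if_same.
rewrite big_mkcond (bigD1 a) //= fa big1 ?addr0 => [|b /fb ->].
  by case: ifPn => // /rep_cast_neq ->.
by rewrite rep_cast0 if_same.
Qed.

Lemma colim_eps_kernel (L : lmodType R) (c : cocone (rep_functor F) L)
    (L' : lmodType R) (u : {linear chain0 F -> L'}) (phi : chain0 F) :
    is_colimit c -> (forall f, u (boundary f) = 0) ->
  colim_eps c phi = 0 -> u phi = 0.
Proof.
move=> c_colim u0 eps0.
pose D := rep_functor F.
pose leg' (x : path_category G) : {linear D x -> L'} :=
  u \o chain0_single x.
have leg'_natural (x y : path_category G) (p : mor x y) :
    leg' y \o fmap D p =1 leg' x.
  (* Induction on the path leaves only its last arrow, where the two sides differ by [u] of a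
     boundary. *)
  elim: p => //= a p IHp m; rewrite -(IHp m) /=.
  have [f df] := boundary_single a (rep_path F p m).
  by apply/eqP; rewrite -subr_eq0 -linearB -df u0.
have [w [cw _]] := c_colim L' (Cocone leg'_natural).
(* Summed over the vertices, the factorization through [w] says that [u phi] is [w] applied to
   [colim_eps c phi]. *)
rewrite (chain0_sum_single phi) linear_sum -[RHS](linear0 w) -eps0 [RHS]linear_sum.
by apply: eq_bigr => v _; rewrite -[RHS]/((w \o c v) (phi v)) cw.
Qed.

End Boundary.

Theorem theorem5p1 (R : fieldType) (G : finGraph) (E : {set vertex G})
    (F : representation R G) (finF : forall v, finite_dimensional (F v))
    (ip : internal_product (chain1 F)) (ip_eucl : euclidean ip)
    (L : lmodType R) (c : cocone (rep_functor F) L) (c_colim : is_colimit c)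
    (phi : chain0 F) (phiE : supported_on E phi) (eps0 : colim_eps c phi = 0) :
  exists! f : chain1 F,
    boundary f = phi /\ forall g : chain1 F, is_flow g -> ip f g = 0.
Proof.
have fin1 : finite_dimensional (chain1 F) by apply: dsum_finite_dimensional.
have fin0 : finite_dimensional (chain0 F) by apply: dsum_finite_dimensional.
have [u uP] := linear_cokernel R _ _ (@boundary R G F) fin1 fin0.
have /uP[f0 df0] : u phi = 0.
  apply: (@colim_eps_kernel _ _ _ _ c _ u) => // f.
  by apply/uP; exists f.
have [g dg g_orth] := anisotropic_orthogonal_proj R _ _ ip (@boundary R G F)
  fin1 fin0 ip_eucl f0.
exists (f0 - g); split=> [|f [df f_orth]].
  by split=> //; rewrite linearB /= df0 dg subr0.
have flow_diff : is_flow (f0 - g - f).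
  by rewrite /is_flow !linearB /= df0 dg subr0 df subrr.
(* Both [f0 - g] and [f] are orthogonal to every flow, in particular to their own difference. *)
apply/eqP; rewrite -subr_eq0; apply/eqP/ip_eucl.
by rewrite linearBl /= g_orth // f_orth // subrr.
Qed.
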